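(* Let $G$ be a non-regular graph. Then $G$ has a nonempty proper induced subgraph $H$ that is unique due to its structure or due to its connection to the rest of the graph; that is, either (i) no other induced subgraph of $G$ is isomorphic to $H$, or (ii) there is no induced subgraph $H'$ of $G$ with $V(H')\neq V(H)$ such that the connection of $H'$ to the rest of $G$ is similar to the connection of $H$ to the rest of $G$.
   Context: All graphs are finite and simple. For an induced subgraph $H$ of $G$, $G\setminus V(H)$ denotes the induced subgraph on $V(G)-V(H)$. The connection of $H$ to the rest of $G$ is the triple $(H,\,G\setminus V(H),\,S_H)$, where $S_H$ is the multiset of the sets $N(x)\cap (V(G)-V(H))$, $x\in V(H)$ (the shadows that the vertices of $H$ make on $G\setminus V(H)$). For two induced subgraphs $H,H'$ of $G$, the connection of $H$ to the rest of the graph is similar to that of $H'$ if: (I) $H$ is isomorphic to $H'$; (II) $G\setminus V(H)$ is isomorphic to $G\setminus V(H')$; (III) the shadow multisets $S_H$ and $S_{H'}$ are isomorphic, i.e. some graph isomorphism $G\setminus V(H)\to G\setminus V(H')$ maps the multiset $S_H$ onto the multiset $S_{H'}$. *)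

(* Defs.v *)
From mathcomp Require Import all_boot.
Set Implicit Arguments.
Unset Strict Implicit.
Unset Printing Implicit Defensive.

Structure sgraph := SGraph {
  vertex :> finType;
  adj : rel vertex;
  adj_sym : symmetric adj;
  adj_irrefl : irreflexive adj }.

Definition nbhd (G : sgraph) (x : G) : {set G} := [set y | adj x y].

Definition regular (G : sgraph) : Prop :=
  exists d : nat, forall x : G, #|nbhd x| = d.

Definition is_iso (G1 G2 : sgraph) (f : G1 -> G2) : Prop :=
  bijective f /\ forall x y : G1, adj (f x) (f y) = adj x y.

Definition isomorphic (G1 G2 : sgraph) : Prop :=
  exists f : G1 -> G2, is_iso f.

Section Induced.
Variables (G : sgraph) (H : {set G}).

Definition induced_adj : rel {x : G | x \in H} :=
  fun x y => adj (val x) (val y).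

Lemma induced_sym : symmetric induced_adj.
Proof. by move=> x y; apply: adj_sym. Qed.

Lemma induced_irrefl : irreflexive induced_adj.
Proof. by move=> x; apply: adj_irrefl. Qed.

Definition induced : sgraph := SGraph induced_sym induced_irrefl.

End Induced.

(* The vertices of [induced (~: H)] form a subtype of those of [G], so the
   shadow N(x) :&: ~: H is the preimage of N(x) under [val]. *)
Definition shadow (G : sgraph) (H : {set G}) (x : induced H) :
    {set induced (~: H)} :=
  [set y | val y \in nbhd (val x)].

(* The multiset of shadows is a sequence taken up to [perm_eq]. *)
Record connection := Connection {
  part : sgraph;
  rest : sgraph;
  shadows : seq {set rest} }.

Definition connection_of (G : sgraph) (H : {set G}) : connection :=
  @Connection (induced H) (induced (~: H)) [seq shadow x | x : induced H].

Definition similar (c c' : connection) : Prop :=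
  [/\ isomorphic (part c) (part c'),
      isomorphic (rest c) (rest c')
    & exists2 f : rest c -> rest c', is_iso f &
        perm_eq [seq f @: A | A : {set rest c} <- shadows c] (shadows c')].

(* Main.v *)
Require Import Defs.
From mathcomp Require Import all_boot.

(** The connection of [H] to the rest of [G] determines the number of vertices
    of [H] and the sum of the [G]-degrees of these vertices: each neighbour of
    a vertex of [H] lies either in [H], where it is counted by the structure of
    [H], or outside, where it is counted by the shadow of the vertex.

    Let [H] consist of the vertices of maximum degree.  Among the sets with
    #|H| vertices it is the only one that attains the largest possible degree
    sum, so no other set has a similar connection.  It is nonempty and proper
    because [G] is not regular. *)

Lemma card_isomorphic (G1 G2 : sgraph) : isomorphic G1 G2 -> #|G1| = #|G2|.
Proof. by case=> f [/bij_eq_card]. Qed.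

Lemma card_nbhd_iso (G1 G2 : sgraph) (f : G1 -> G2) (x : G1) :
  is_iso f -> #|nbhd (f x)| = #|nbhd x|.
Proof.
move=> [[g fK gK] f_adj]; rewrite -(card_imset (nbhd x) (can_inj fK)).
rewrite (can2_imset_pre _ fK gK); apply: eq_card => y.
by rewrite !inE -f_adj gK.
Qed.

Lemma isomorphic_degree_sum (G1 G2 : sgraph) :
  isomorphic G1 G2 -> \sum_(x : G1) #|nbhd x| = \sum_(x : G2) #|nbhd x|.
Proof.
move=> [f f_iso]; rewrite [RHS](reindex f) /=; last by apply: onW_bij; case: f_iso.
by apply: eq_bigr => x _; rewrite card_nbhd_iso.
Qed.

Lemma card_induced (G : sgraph) (H : {set G}) : #|induced H| = #|H|.
Proof. by rewrite card_sig. Qed.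

(** With [K = H] the left-hand side is a degree in [induced H], and with
    [K = ~: H] it is the size of a shadow. *)
Lemma card_nbhd_in (G : sgraph) (K : {set G}) (x : G) :
  #|[set y : induced K | val y \in nbhd x]| = #|nbhd x :&: K|.
Proof.
rewrite -(card_imset _ val_inj); apply: eq_card => y.
rewrite in_setI; apply/imsetP/andP => [[z + ->] | [xy Ky]].
  by rewrite inE => xz; split=> //; apply: valP.
by exists (exist _ y Ky : induced K); rewrite ?inE /= -?in_set.
Qed.

Lemma card_nbhd_split (G : sgraph) (H : {set G}) (x : induced H) :
  #|nbhd (val x)| = #|nbhd x| + #|shadow x|.
Proof.
rewrite -(cardsID H) setDE -!card_nbhd_in; congr (_ + _).
by apply: eq_card => y; rewrite !inE.
Qed.

Definition connection_degree_sum (c : connection) :=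
  \sum_(x : part c) #|nbhd x| + \sum_(A <- shadows c) #|A|.

Lemma connection_degree_sumE (G : sgraph) (H : {set G}) :
  connection_degree_sum (connection_of H) = \sum_(x in H) #|nbhd x|.
Proof.
rewrite /connection_degree_sum /= big_map big_enum /= -big_split /=.
rewrite [RHS]big_sub /=.
by apply: eq_bigr => x _; rewrite card_nbhd_split.
Qed.

Lemma similar_degree_sum (c c' : connection) :
  similar c c' -> connection_degree_sum c = connection_degree_sum c'.
Proof.
case=> partcc' _ [f [/bij_inj f_inj _] f_shadows].
rewrite /connection_degree_sum (isomorphic_degree_sum _ _ partcc').
congr (_ + _); rewrite -(perm_big _ f_shadows) big_map.
by apply: eq_bigr => A _; rewrite card_imset.
Qed.

(** A sum of #|A| terms bounded by [m] reaches #|A| * m only if every term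
    equals [m], hence [A] is included in the set of maximizers. *)
Lemma argmax_set_unique (T : finType) (F : T -> nat) (m : nat) (A : {set T}) :
    (forall x, F x <= m) -> #|A| = #|[set x | F x == m]| ->
    \sum_(x in A) F x = \sum_(x in [set x | F x == m]) F x ->
  A = [set x | F x == m].
Proof.
set M := [set x | _] => F_le cardA sumA.
have sumM : \sum_(x in M) F x = #|M| * m.
  by rewrite -sum_nat_const; apply: eq_bigr => x; rewrite inE => /eqP.
apply/eqP; rewrite eqEcard cardA leqnn andbT; apply/subsetP => x Ax.
have [_] := leqif_sum (fun i (_ : i \in A) => leqif_eq (F_le i)).
rewrite sum_nat_const sumA sumM cardA eqxx => /esym/forall_inP/(_ x Ax).
by rewrite inE.
Qed.

Theorem lemma8 (G : sgraph) (nreg : ~ regular G) :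
  exists H : {set G},
    [/\ H != set0, H \proper [set: G]
      & (forall H' : {set G}, H' != H ->
           ~ isomorphic (induced H') (induced H)) \/
        ~ (exists2 H' : {set G}, H' != H &
             similar (connection_of H') (connection_of H))].
Proof.
pose m := \max_(x : G) #|nbhd x|.
exists [set x | #|nbhd x| == m]; split.
- have G_gt0 : 0 < #|G|.
    rewrite lt0n; apply/negP => /eqP/card0_eq G0.
    by apply: nreg; exists 0 => x; have := G0 x; rewrite inE.
  have [x xm] := eq_bigmax (fun x : G => #|nbhd x|) G_gt0.
  by apply/set0Pn; exists x; rewrite inE /m xm.
- rewrite properT; apply/eqP => H_full; apply: nreg; exists m => x.
  by apply/eqP; have := in_setT x; rewrite -H_full inE.
- right=> -[H' /eqP neqH' simH']; apply/neqH'/argmax_set_unique.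
  + by move=> x; apply: leq_bigmax.
  + by case: simH' => /card_isomorphic; rewrite !card_induced.
  + by rewrite -!connection_degree_sumE; apply: similar_degree_sum.
Qed.
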